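(* Let $n$ be a positive integer and let $A$ be a Cartan matrix of finite type. Let $u_A$ denote the largest value taken by frieze patterns of type $A$ (as defined in the context). Then: (1) if $A$ is of type $A_n$, then $u_A = F_{n+2}$; (2) if $A$ is of type $C_n$, then $u_A = F_{2n+1}$; where $F_k$ is the $k$-th Fibonacci number, defined by $F_0 = 0$, $F_1 = 1$ and $F_{k+2} = F_{k+1} + F_k$ for $k \ge 0$.
   Context: A symmetrisable generalised Cartan matrix is an $n\times n$ integer matrix $A = (a_{i,j})$ such that $a_{i,i}=2$ for all $i$; $a_{i,j}\le 0$ for $i\ne j$, with $a_{i,j}=0$ if and only if $a_{j,i}=0$; and there is a diagonal matrix $D$ with positive integer diagonal entries such that $DA$ is symmetric. It is of finite type if it is positive definite. The (standard) Cartan matrix of type $A_n$ is the $n\times n$ matrix with $a_{i,i}=2$ for all $i$, $a_{i,j}=-1$ if $|i-j|=1$, and $a_{i,j}=0$ otherwise. The (standard) Cartan matrix of type $C_n$ is the $n \times n$ matrix obtained from it by replacing the entry $a_{n-1,n}=-1$ by $a_{n-1,n}=-2$ (so $a_{n,n-1}=-1$ is unchanged; for $n=1$ the matrix is $(2)$). In this theorem ''$A$ is of type $A_n$'' (resp. ''$C_n$'') means that $A$ is the corresponding standard Cartan matrix. For an $n\times n$ symmetrisable generalised Cartan matrix $A=(a_{i,j})$, a frieze pattern of type $A$ is a map $f:\{1,\ldots,n\}\times\mathbb{Z}\to\mathbb{Z}_{>0}$ such that for all $i\in\{1,\ldots,n\}$ and all $m\in\mathbb{Z}$, $$f(i,m)\,f(i,m+1)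 = 1+\prod_{j=i+1}^{n} f(j,m)^{-a_{j,i}}\prod_{j=1}^{i-1} f(j,m+1)^{-a_{j,i}},$$ where empty products equal $1$. The set of frieze patterns of type $A$ is denoted $\mathrm{Frieze}(A)$. Explicitly, for type $A_n$ the relation reads $f(i,m)f(i,m+1)=1+f(i+1,m)f(i-1,m+1)$ for $1\le i\le n$, with the convention $f(0,m)=f(n+1,m)=1$ for all $m$. For type $C_n$ it reads $f(i,m)f(i,m+1)=1+f(i+1,m)f(i-1,m+1)$ for $1\le i\le n-1$ and $f(n,m)f(n,m+1)=1+f(n-1,m+1)^2$, with the convention $f(0,m)=1$ for all $m$. For $A$ of finite type, set $$u_A := \max\{f(i,m) : f\in \mathrm{Frieze}(A),\ i\in\{1,\ldots,n\},\ m\in\mathbb{Z}\}.$$ (For $A$ of finite type it is known that $\mathrm{Frieze}(A)$ is finite and each frieze pattern is periodic in $m$, so this maximum exists.) *)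

(* Defs.v *)
From Stdlib Require Rdefinitions.
From mathcomp Require Import all_boot all_order all_algebra.
From mathcomp Require Import Rstruct.

Set Implicit Arguments.
Unset Strict Implicit.
Unset Printing Implicit Defensive.

Import Order.TTheory GRing.Theory Num.Theory.

Local Open Scope ring_scope.

(* Throughout, the index set {1, ..., n} is 'I_n = {0, ..., n-1}: the row or
   column usually numbered i is the ordinal of value i - 1. *)

(* [d] is the diagonal of the symmetrising matrix D. *)
Definition symmetriser n (d : 'rV[int]_n) (A : 'M[int]_n) : Prop :=
  (forall i, 0 < d 0 i) /\ (diag_mx d *m A)^T = diag_mx d *m A.

Definition symmetrisable_GCM n (A : 'M[int]_n) : Prop :=
  [/\ forall i, A i i = 2,
      forall i j, i != j -> A i j <= 0,
      forall i j, i != j -> (A i j = 0 <-> A j i = 0)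
    & exists d, symmetriser d A].

Definition posdefmx n (B : 'M[Rdefinitions.R]_n) : Prop :=
  forall x : 'cV[Rdefinitions.R]_n, x != 0 -> 0 < (x^T *m B *m x) 0 0.

(* A itself need not be symmetric: calling a symmetrisable A positive definite
   means that its symmetrisation D A is.  This does not depend on the choice
   of D. *)
Definition finite_type n (A : 'M[int]_n) : Prop :=
  symmetrisable_GCM A /\
  exists2 d, symmetriser d A & posdefmx (map_mx intr (diag_mx d *m A)).

Definition cartanA n : 'M[int]_n :=
  \matrix_(i, j) if i == j then 2
                 else if (i.+1 == j :> nat) || (j.+1 == i :> nat) then -1
                 else 0.

(* The modified entry is the one in the last column and the row above the last
   one; there is none when n = 1. *)
Definition cartanC n : 'M[int]_n :=
  \matrix_(i, j) if (i.+2 == n) && (j.+1 == n) then -2 else cartanA n i j.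

(* [^] is the integer power of ssrint; for a generalised Cartan matrix the
   exponents - A j i with j != i are nonnegative, so these are ordinary powers
   and no inverse occurs. *)
Definition frieze n (A : 'M[int]_n) (f : 'I_n -> int -> int) : Prop :=
  (forall i m, 0 < f i m) /\
  (forall i m, f i m * f i (m + 1) =
     1 + (\prod_(j < n | (i < j)%N) f j m ^ (- A j i))
         * (\prod_(j < n | (j < i)%N) f j (m + 1) ^ (- A j i))).

Definition frieze_value n (A : 'M[int]_n) (v : int) : Prop :=
  exists f, frieze A f /\ exists i m, v = f i m.

(* "u_A exists and equals u" *)
Definition is_max_frieze_value n (A : 'M[int]_n) (u : int) : Prop :=
  frieze_value A u /\ forall v, frieze_value A v -> v <= u.

Fixpoint fib (k : nat) : nat :=
  match k with
  | 0 => 0%N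
  | k'.+1 => match k' with
             | 0 => 1%N
             | k''.+1 => (fib k' + fib k'')%N
             end
  end.

(* Main.v *)
Require Import Defs.
From mathcomp Require Import all_boot all_order all_algebra.
From mathcomp Require Import zify ring.

(** Write a frieze with its two boundary rows of ones.  In type A, the entries for
    a fixed m form a sequence d_0, ..., d_(n+1) of positive integers with
    d_0 = d_(n+1) = 1, and the diamond rule forces d_i to divide
    d_(i-1) + d_(i+1) for 1 <= i <= n ([table_dvd]).  In such a sequence the last
    occurrence of the maximum, when that is not 1, is the sum of its two
    neighbours; deleting it leaves a shorter sequence of the same kind.  So the
    sequence grows from constant ones by inserting sums of neighbours, and both
    its entries and the sums of adjacent entries are bounded by Fibonacci
    numbers ([chain_le_fib]).  In the Conway-Coxeter picture this is the removal
    of an ear of a triangulated polygon with n + 3 vertices.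

    A frieze of type C_n is the upper half of a frieze of type A_(2n-1)
    symmetric under a glide reflection: the squared entry in its last relation
    is the product of the two equal neighbours of the middle row
    ([table_unfold], [table_fold]).  Hence the bound for C_n is the one for
    A_(2n-1).

    The bounds are attained by the frieze of the zigzag triangulation.  Its
    vertices, listed along the zigzag, are the vectors (F_(t+1), F_t) for
    0 <= t <= n + 2, whose determinants are Fibonacci numbers up to sign
    ([det2_fib_vec]); the two ends of the zigzag give F_(n+2).  Sorted around
    the polygon, even t increasing and then odd t decreasing, all determinants
    become positive, and the Pluecker relation is the diamond rule
    ([table_of_polygon]).  When the number of vertices is even, the half turn of
    the polygon reverses the zigzag, so the frieze folds to type C, with its
    maximum on the middle row. *)

Set Implicit Arguments.
Unset Strict Implicit.
Unset Printing Implicit Defensive.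

Import Order.TTheory GRing.Theory Num.Theory.

Local Open Scope ring_scope.

(** * Fibonacci bound for divisibility chains *)

Arguments fib : simpl never.

Lemma fibSS k : fib k.+2 = (fib k.+1 + fib k)%N.
Proof. by []. Qed.

Lemma fib_gt0 k : (0 < fib k.+1)%N.
Proof. by elim: k => // k IHk; rewrite fibSS addn_gt0 IHk. Qed.

Lemma leq_fibS k : (fib k <= fib k.+1)%N.
Proof. by case: k => // k; rewrite fibSS leq_addr. Qed.

Lemma last_maximum (d : nat -> nat) m :
  exists2 j, (j <= m)%N &
    (forall i, i <= m -> d i <= d j)%N /\ (forall i, j < i <= m -> d i < d j)%N.
Proof.
elim: m => [|m [j le_jm [dj dj']]].
  by exists 0%N => //; split=> i; [rewrite leqn0 => /eqP-> | lia].
have [lt_d|le_d] := ltnP (d m.+1) (d j).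
  exists j; first exact: leqW.
  split=> i.
    by rewrite leq_eqVlt => /orP[/eqP->|]; [exact: ltnW | exact: dj].
  case/andP=> lt_ji; rewrite leq_eqVlt => /orP[/eqP-> //|le_im].
  by apply: dj'; rewrite lt_ji.
exists m.+1 => //; split=> i; last lia.
rewrite leq_eqVlt => /orP[/eqP-> //|le_im].
exact: leq_trans (dj _ le_im) le_d.
Qed.

Section DivisibilityChains.

Local Open Scope nat_scope.

Record divisibility_chain m (d : nat -> nat) : Prop := DivisibilityChain {
  chain_first : d 0 = 1;
  chain_last : d m = 1;
  chain_gt0 i : i <= m -> 0 < d i;
  chain_dvd i : 0 < i < m -> d i %| d i.-1 + d i.+1 }.

(** A last maximum d j exceeds its right neighbour and is at least its left one,
    so the sum of the neighbours is a positive multiple of d j below 2 d j. *)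
Lemma chain_mediant m d : divisibility_chain m d ->
  (exists2 i, i <= m & 1 < d i) ->
  exists2 j, 0 < j < m & d j = d j.-1 + d j.+1.
Proof.
case=> d0 dm d_gt0 d_dvd [i0 le_i0m d_gt1].
have [j le_jm [d_le d_lt]] := last_maximum d m.
have dj_gt1 : 1 < d j by exact: leq_trans (d_le _ le_i0m).
have j_gt0 : 0 < j by case: j dj_gt1 {le_jm d_le d_lt} => //; rewrite d0.
have lt_jm : j < m.
  by rewrite ltn_neqAle le_jm andbT; apply: contraL dj_gt1 => /eqP->; rewrite dm.
exists j; first by rewrite j_gt0.
have /dvdnP[c Ec] : d j %| d j.-1 + d j.+1 by apply: d_dvd; rewrite j_gt0.
have le1 : d j.-1 <= d j by apply: d_le; lia.
have lt1 : d j.+1 < d j by apply: d_lt; lia.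
have pos : 0 < d j.+1 by apply: d_gt0.
by rewrite Ec; case: c Ec => [|[|c]] Ec; [lia | rewrite mul1n | nia].
Qed.

Lemma bump_lt j i : i < j -> bump j i = i.
Proof. by rewrite /bump ltnNge => /negbTE->. Qed.

Lemma bump_ge j i : j <= i -> bump j i = i.+1.
Proof. by rewrite /bump => ->. Qed.

(** Only the conditions at the two neighbours of j change.  There, d j is replaced
    by the other neighbour, which differs from it by the very entry whose
    divisibility is at stake. *)
Lemma chain_delete m d j : divisibility_chain m.+1 d ->
  0 < j < m.+1 -> d j = d j.-1 + d j.+1 ->
  divisibility_chain m (d \o bump j).
Proof.
case=> d0 dm d_gt0 d_dvd /andP[j_gt0 lt_jm] dj; split=> [||i le_im|i /andP[i_gt0 lt_im]] /=.
- by rewrite bump_lt.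
- by rewrite bump_ge.
- by apply: d_gt0; rewrite /bump; case: (j <= i); rewrite ?ltnS // leqW.
have [lt_ij|] := ltnP i.+1 j.
  have lt_ij' := ltnW lt_ij.
  rewrite !bump_lt ?(leq_ltn_trans (leq_pred i)) //.
  by apply: d_dvd; rewrite i_gt0 ltnW.
rewrite leq_eqVlt => /predU1P[Ej|].
  rewrite Ej in dj *; rewrite (bump_ge (leqnn i.+1)) !bump_lt ?ltnS ?leq_pred //.
  by have := d_dvd i; rewrite i_gt0 ltnW // dj addnCA dvdn_addr //; apply.
rewrite ltnS leq_eqVlt => /predU1P[Ej|lt_ji].
  rewrite Ej in dj *; rewrite (bump_ge (leqnn i)) (bump_ge (leqnSn i)) bump_lt ?prednK //.
  by have := d_dvd i.+1 lt_im; rewrite /= dj -addnA addnCA dvdn_addr.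
have le_ji := ltnW lt_ji.
have le_ji' : j <= i.-1 by rewrite -ltnS prednK.
rewrite (bump_ge le_ji) (bump_ge (leqW le_ji)) (bump_ge le_ji') prednK //.
exact: d_dvd i.+1 lt_im.
Qed.

(** The bound on sums of adjacent entries is what makes the induction work: the
    deleted entry is such a sum in the shorter chain, and the two new adjacent
    sums are the deleted entry plus an entry of the shorter chain. *)
Lemma chain_le_fib m d : divisibility_chain m d ->
  (forall i, i <= m -> d i <= fib m.+1) /\
  (forall i, i < m -> d i + d i.+1 <= fib m.+2).
Proof.
elim: m d => [|m IHm] d chain_d.
  by split=> // i; rewrite leqn0 => /eqP->; rewrite (chain_first chain_d).
have [/forallP d_le1|] := boolP [forall i : 'I_m.+2, d i <= 1].
  have le1 i : i <= m.+1 -> d i <= 1 by move=> le_im; exact: (d_le1 (Ordinal (le_im : i < m.+2))).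
  have := fib_gt0 m; have := fib_gt0 m.+1.
  split=> i lt_im; first by apply: leq_trans (le1 i lt_im) _.
  by have := le1 i (ltnW lt_im); have := le1 i.+1 lt_im; rewrite (fibSS m.+1); lia.
rewrite negb_forall => /existsP[[i0 lt_i0]] /=; rewrite -ltnNge => d_gt1.
have [|j j_in dj] := chain_mediant chain_d; first by exists i0.
have [P Q] := IHm _ (chain_delete chain_d j_in dj).
have {P} P i : i <= m.+1 -> i <> j -> d i <= fib m.+1.
  move=> le_im ne_ij; have [lt_ij|le_ji] := ltnP i j.
    by have := P i; rewrite /= bump_lt //; apply; lia.
  have i_gt0 : 0 < i by lia.
  by have := P i.-1; rewrite /= bump_ge ?prednK //; [apply; lia | lia].
have Qj : d j <= fib m.+2.
  have /andP[j_gt0 _] := j_in.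
  by have := Q j.-1; rewrite /= prednK // bump_lt ?prednK // bump_ge // -dj; apply; lia.
have {}Q i : i < m.+1 -> i <> j -> i.+1 <> j -> d i + d i.+1 <= fib m.+2.
  move=> lt_im ne_ij ne_ij'; have [lt_ij|le_ji] := ltnP i j.
    by have := Q i; rewrite /= !bump_lt //; [apply; lia | lia].
  have i_gt0 : 0 < i by lia.
  by have := Q i.-1; rewrite /= prednK // !bump_ge ?prednK //; [apply; lia | lia].
split=> i.
  have [-> _ //|/eqP ne_ij le_im] := eqVneq i j.
  exact: leq_trans (P i le_im ne_ij) (leq_fibS _).
move=> lt_im; rewrite (fibSS m.+1).
have [Eij|/eqP ne_ij] := eqVneq i j.
  by rewrite Eij; apply: leq_add => //; apply: P; lia.
have [Eij|/eqP ne_ij'] := eqVneq i.+1 j.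
  by rewrite addnC Eij; apply: leq_add => //; apply: P; lia.
exact: leq_trans (Q i lt_im ne_ij ne_ij') (leq_addr _ _).
Qed.

End DivisibilityChains.

(** * Friezes with their boundary rows *)

(** The flag [c] selects type C over type A.  The exponent is that of the row
    above in the relation of the row numbered [i] from 0: it is 2 for the last
    row in type C. *)
Definition row_exponent (c : bool) n (i : nat) : nat := (c && (i.+1 == n)).+1.

Definition cartan_type (c : bool) n : 'M[int]_n :=
  if c then cartanC n else cartanA n.

(** Rows are numbered from 1 to n, as usual on paper, with rows 0 and n+1 constant
    equal to 1; row i.+1 is thus indexed by the ordinal of value i. *)
Record frieze_table c n (g : nat -> int -> int) : Prop := FriezeTable {
  table_top m : g 0%N m = 1;
  table_bottom m : g n.+1 m = 1;
  table_gt0 i m : (i <= n.+1)%N -> 0 < g i m;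
  table_diamond i m : (i < n)%N ->
    g i.+1 m * g i.+1 (m + 1)
    = 1 + g i.+2 m * g i (m + 1) ^+ row_exponent c n i }.

Definition pad_rows n (f : 'I_n -> int -> int) (i : nat) (m : int) : int :=
  if i is k.+1 then oapp (f^~ m) 1 (insub k) else 1.

Arguments pad_rows : simpl never.

Lemma pad_rows_ord n (f : 'I_n -> int -> int) (i : 'I_n) m :
  pad_rows f i.+1 m = f i m.
Proof. by rewrite /pad_rows valK. Qed.

Lemma pad_rows_out n (f : 'I_n -> int -> int) i m :
  (n < i)%N -> pad_rows f i m = 1.
Proof. by case: i => // i lt_ni; rewrite /pad_rows insubF // ltnNge -ltnS lt_ni. Qed.

(** The column of the Cartan matrix has at most one nonzero entry on either side of
    the diagonal.  At an end of the diagram the product is empty, which the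
    boundary row accounts for. *)
Lemma prod_rows_above c n (g : nat -> int) (i : 'I_n) : g n.+1 = 1 ->
  \prod_(j < n | (i < j)%N) g j.+1 ^ (- cartan_type c n j i) = g i.+2.
Proof.
move=> g1.
have E (j : 'I_n) : (i < j)%N ->
    g j.+1 ^ (- cartan_type c n j i) = if j == i.+1 :> nat then g i.+2 else 1.
  move=> lt_ij; rewrite /cartan_type.
  have -> : (if c then cartanC n else cartanA n) j i = if j == i.+1 :> nat then -1 else 0.
    case: c; rewrite !mxE -?val_eqE /=; have := ltn_ord j;
      do ![case: eqP => //=]; lia.
  by case: eqP => [->|_].
rewrite (eq_bigr _ E) -big_mkcondr /=.
have [lt_i|le_n] := ltnP i.+1 n.
  rewrite (big_pred1 (Ordinal lt_i)) // => j.
  by rewrite /= -val_eqE /=; lia.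
rewrite big_pred0 => [|j]; last by have := ltn_ord j; lia.
by rewrite -g1; congr (g _.+1); have := ltn_ord i; lia.
Qed.

Lemma prod_rows_below c n (g : nat -> int) (i : 'I_n) : g 0%N = 1 ->
  \prod_(j < n | (j < i)%N) g j.+1 ^ (- cartan_type c n j i)
  = g i ^+ row_exponent c n i.
Proof.
move=> g0.
have E (j : 'I_n) : (j < i)%N ->
    g j.+1 ^ (- cartan_type c n j i)
    = if j.+1 == i :> nat then g i ^+ row_exponent c n i else 1.
  move=> lt_ji; rewrite /cartan_type.
  have -> : (if c then cartanC n else cartanA n) j i
      = if j.+1 == i :> nat then - (row_exponent c n i)%:Z else 0.
    rewrite /row_exponent.
    case: c; rewrite !mxE -?val_eqE /=; have := ltn_ord j;
      do ![case: eqP => //=]; lia.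
  by case: eqP => [->|_] //; rewrite opprK.
rewrite (eq_bigr _ E) -big_mkcondr /=.
case Ei: (nat_of_ord i) => [|k]; first by rewrite g0 expr1n big_pred0.
have lt_k : (k < n)%N by have := ltn_ord i; lia.
rewrite (big_pred1 (Ordinal lt_k)) // => j.
by rewrite /= -val_eqE /=; lia.
Qed.

Lemma frieze_of_table c n g : frieze_table c n g ->
  frieze (cartan_type c n) (fun i => g i.+1).
Proof.
case=> top bot g_gt0 diamond; split=> i m; first by apply: g_gt0; exact: ltnW (ltn_ord i).
by rewrite diamond // (prod_rows_above c (g := g^~ m)) // (prod_rows_below c (g := g^~ (m + 1))).
Qed.

Lemma table_of_frieze c n f : frieze (cartan_type c n) f ->
  frieze_table c n (pad_rows f).
Proof.
case=> f_gt0 f_rel; split=> // [m|[|i] m le_in|i m lt_in] //.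
- by rewrite pad_rows_out.
- have [lt_in|le_ni] := ltnP i n; last by rewrite pad_rows_out.
  by rewrite (pad_rows_ord f (Ordinal lt_in)).
have := f_rel (Ordinal lt_in) m.
rewrite -!(pad_rows_ord f) /= => ->.
have /= <- := prod_rows_above c (g := (pad_rows f)^~ m) (Ordinal lt_in)
  (pad_rows_out f m (ltnSn n)).
have /= <- := prod_rows_below c (g := (pad_rows f)^~ (m + 1)) (Ordinal lt_in) erefl.
by congr (1 + _ * _); apply: eq_bigr => j _; rewrite pad_rows_ord.
Qed.

(** * Folding type A_(2n-1) onto type C_n *)

(** The rows below the middle row n are the images of those above under the glide
    reflection sending (n - k, m + k) to (n + k, m). *)
Definition unfold_table n (g : nat -> int -> int) (i : nat) (m : int) : int :=
  if (i <= n)%N then g i m else g (n.*2 - i)%N (m + (i - n)%:Z).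

Lemma table_unfold n g : (0 < n)%N -> frieze_table true n g ->
  frieze_table false n.*2.-1 (unfold_table n g).
Proof.
case: n => // n _ [top bot g_gt0 diamond]; rewrite doubleS /=.
have unfold_le i m : (i <= n.+1)%N -> unfold_table n.+1 g i m = g i m.
  by rewrite /unfold_table => ->.
have unfold_ge i m : (n < i)%N ->
    unfold_table n.+1 g i m = g (n.+1.*2 - i)%N (m + (i - n.+1)%:Z).
  rewrite /unfold_table leq_eqVlt => /predU1P[<-|lt_ni].
    by rewrite leqnn subnn addr0 -addnn addnK.
  by rewrite leqNgt lt_ni.
split=> [m|m|i m le_i|i m lt_i].
- exact: top.
- by rewrite unfold_ge -?doubleS ?subnn ?top // doubleS; lia.
- by rewrite /unfold_table; case: ifP => ?; apply: g_gt0; lia.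
rewrite /row_exponent /= expr1.
have [lt_in|lt_ni|Ei] := ltngtP i n.
(* Rows strictly above the middle one: the relation is that of g. *)
- rewrite !unfold_le ?(leqW lt_in) ?(leqW (ltnW lt_in)) // diamond ?leqW //.
  by rewrite /row_exponent eqSS ltn_eqF.
(* Rows strictly below: the relation of g at the reflected position. *)
- have [k Ek] : exists k, (n.+1.*2 - i.+2)%N = k by exists (n.+1.*2 - i.+2)%N.
  rewrite !unfold_ge; try lia.
  rewrite Ek (_ : n.+1.*2 - i.+1 = k.+1)%N; last lia.
  rewrite (_ : n.+1.*2 - i = k.+2)%N; last lia.
  have /= := diamond k (m + (i - n)%:Z); rewrite subSS.
  rewrite /row_exponent ltn_eqF /= ?expr1; last lia.
  rewrite (addrAC m 1) => ->; last lia.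
  rewrite mulrC; congr (1 + g k _ * g _ _); lia.
(* The middle row: the rows next to it agree, giving the square of type C. *)
- rewrite Ei (@unfold_ge n.+2) // !unfold_le ?leqnSn // diamond //.
  rewrite bot mul1r /row_exponent /= eqxx expr2.
  by congr (1 + g _ _ * _); lia.
Qed.

(** The equality of the two rows adjacent to the middle row n turns its relation
    into that of type C; row n+1 then becomes the boundary row of ones. *)
Lemma table_fold n g : (0 < n)%N -> frieze_table false n.*2.-1 g ->
  (forall m, g n.+1 m = g n.-1 (m + 1)) ->
  frieze_table true n (fun i m => if i == n.+1 then 1 else g i m).
Proof.
case: n => // n _; rewrite doubleS => -[top _ g_gt0 diamond] /= sym.
split=> [m|m|i m le_in|i m lt_in]; rewrite ?eqxx ?top //.
  by case: ifP => // _; apply: g_gt0; lia.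
have -> : (i.+1 == n.+2) = false by lia.
have -> : (i == n.+2) = false by lia.
rewrite diamond /row_exponent /= ?expr1; last lia.
rewrite !eqSS; case: eqP => [->|_]; last by rewrite expr1.
by rewrite sym mul1r expr2.
Qed.

(** * The upper bound *)

(** The quotient propagates along a diagonal: by the diamond rule at rows i and
    i+1, (g_i(m) + g_(i+2)(m)) / g_(i+1)(m) and the same quotient one row up at
    m + 1 are equal.  On the first row it is the entry g_1(m + 1), an integer. *)
Lemma table_dvd N g i m : frieze_table false N g -> (i < N)%N ->
  exists c, g i m + g i.+2 m = c * g i.+1 m.
Proof.
case=> top bot g_gt0 diamond; elim: i m => [|i IHi] m lt_iN.
  exists (g 1%N (m + 1)).
  by have := diamond 0%N m lt_iN; rewrite !top mulr1 mulrC => ->.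
have [c Ec] := IHi (m + 1) (ltnW lt_iN).
exists c; apply: (mulIf (lt0r_neq0 (g_gt0 i.+1 (m + 1) _))); first by lia.
have E1 := diamond i m (ltnW lt_iN); have E2 := diamond i.+1 m lt_iN.
have -> : (g i.+1 m + g i.+3 m) * g i.+1 (m + 1)
  = (g i (m + 1) + g i.+2 (m + 1)) * g i.+2 m.
  rewrite !mulrDl E1 [g i.+2 (m + 1) * _]mulrC E2; ring.
by rewrite Ec; ring.
Qed.

Lemma table_chain N g m : frieze_table false N g ->
  divisibility_chain N.+1 (fun i => `|g i m|%N).
Proof.
move=> cox; have [top bot g_gt0 _] := cox.
split=> [||i le_iN|[//|i] /= lt_iN]; rewrite ?top ?bot //.
  by rewrite absz_gt0 gt_eqF ?g_gt0.
have [c Ec] := table_dvd m cox (lt_iN : (i < N)%N).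
have g0 := g_gt0 i m; have g2 := g_gt0 i.+2 m.
have -> : (`|g i m| + `|g i.+2 m|)%N = `|(g i m + g i.+2 m)%R|%N by lia.
by rewrite Ec abszM dvdn_mull.
Qed.

Lemma table_le_fib N g i m : frieze_table false N g -> (i <= N.+1)%N ->
  g i m <= (fib N.+2)%:Z.
Proof.
move=> cox le_iN; have [le_fib _] := chain_le_fib (table_chain m cox).
by have := le_fib i le_iN; have := table_gt0 cox m le_iN; lia.
Qed.

(** * Friezes from polygons of vectors *)

Definition det2 (x y : int * int) : int := x.1 * y.2 - x.2 * y.1.

Lemma det2C x y : det2 x y = - det2 y x.
Proof. by rewrite /det2; ring. Qed.

Lemma det2Nl x y : det2 (- x) y = - det2 x y.
Proof. by rewrite /det2 /=; ring. Qed.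

Lemma det2Nr x y : det2 x (- y) = - det2 x y.
Proof. by rewrite /det2 /=; ring. Qed.

Lemma det2_plucker a b c d :
  det2 a c * det2 b d = det2 a b * det2 c d + det2 a d * det2 b c.
Proof. by rewrite /det2; ring. Qed.

Lemma det2_coordinates a b x y :
  det2 (det2 x a, det2 x b) (det2 y a, det2 y b) = det2 a b * det2 x y.
Proof. by rewrite /det2 /=; ring. Qed.

(** Integer vectors lifting the vertices of a convex N-gon: the change of sign
    after one turn is what allows the determinant of any two vertices less than
    one turn apart to be positive, whichever vertex comes first. *)
Record polygon N (v : nat -> int * int) : Prop := Polygon {
  polygon_period r : v (r + N)%N = - v r;
  polygon_edge r : det2 (v r) (v r.+1) = 1;
  polygon_gt0 r k : (0 < k < N)%N -> 0 < det2 (v r) (v (r + k)%N) }.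

(** The frieze entry attached to the chord from vertex m to vertex m + i + 1.  As
    vertices are numbered by natural numbers, m is first reduced modulo N, which
    moves both ends of the chord and so preserves the determinant. *)
Definition polygon_table N (v : nat -> int * int) (i : nat) (m : int) : int :=
  det2 (v `|(m %% N)%Z|%N) (v (`|(m %% N)%Z| + i.+1)%N).

(** If reduction modulo N wraps around between m and m + 1, both end points change
    sign. *)
Lemma polygon_tableS N v i m : (0 < N)%N -> polygon N v ->
  polygon_table N v i (m + 1)
  = det2 (v `|(m %% N)%Z|.+1) (v (`|(m %% N)%Z| + i.+2)%N).
Proof.
move=> N_gt0 [period _ _]; rewrite /polygon_table.
set r := `|(m %% N)%Z|%N.
have rE : (m %% N)%Z = r%:Z by rewrite /r; lia.
have lt_rN : (r < N)%N by rewrite /r; lia.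
rewrite -modzDml rE -PoszD modz_nat addn1 absz_nat.
move: lt_rN; rewrite leq_eqVlt => /predU1P[Er|lt_r]; last by rewrite modn_small // addSnnS.
rewrite Er modnn (_ : r + i.+2 = 0 + i.+1 + N)%N; last lia.
rewrite -[X in det2 (v X) _ = _]/0%N -[X in _ = det2 (v X) _]add0n !period.
by rewrite det2Nl det2Nr opprK.
Qed.

(** The diamond rule is the Pluecker relation for two pairs of consecutive
    vertices.  The bottom row is constant because the vertices m and m + n + 2
    are adjacent around the back of the polygon. *)
Lemma table_of_polygon n v : polygon n.+3 v ->
  frieze_table false n (polygon_table n.+3 v).
Proof.
move=> poly; have [period edge gt0] := poly.
split=> [m|m|i m le_in|i m lt_in].
- by rewrite /polygon_table addn1.
- rewrite /polygon_table; set r := `|_|%N.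
  by rewrite -(edge (r + n.+2)%N) -addnS period det2Nr -det2C.
- by apply: gt0; rewrite /= !ltnS.
rewrite !polygon_tableS // /polygon_table; set r := `|_|%N.
by rewrite !addnS det2_plucker !edge mul1r.
Qed.

(** * The zigzag polygon *)

Definition fib_vec (t : nat) : int * int := ((fib t.+1)%:Z, (fib t)%:Z).

(** D'Ocagne's identity: one Fibonacci step is linear of determinant -1. *)
Lemma det2_fib_vec a b : (a <= b)%N ->
  det2 (fib_vec a) (fib_vec b) = (-1) ^+ a * (fib (b - a))%:Z.
Proof.
elim: a b => [|a IHa] b.
  rewrite subn0 /det2 /= (_ : (fib 1)%:Z = 1) // (_ : (fib 0)%:Z = 0) //.
  by rewrite !mul1r mul0r subr0.
case: b => // b le_ab; rewrite exprS -mulrA subSS -IHa // /det2 /= !fibSS !PoszD.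
by ring.
Qed.

Lemma det2_fib_vec_even a b : ~~ odd a -> (a <= b)%N ->
  det2 (fib_vec a) (fib_vec b) = (fib (b - a))%:Z.
Proof. by move=> ev_a le_ab; rewrite det2_fib_vec // -signr_odd (negbTE ev_a) mul1r. Qed.

Lemma det2_fib_vec_odd a b : odd b -> (b <= a)%N ->
  det2 (fib_vec a) (fib_vec b) = (fib (a - b))%:Z.
Proof.
by move=> odd_b le_ba; rewrite det2C det2_fib_vec // -signr_odd odd_b mulN1r opprK.
Qed.

(** Position along the zigzag 0, 1, ..., N - 1 of the p-th vertex around the
    polygon: first the even positions upwards, then the odd ones downwards. *)
Definition zigzag_index N (p : nat) : nat :=
  if (p.*2 < N)%N then p.*2 else ((N - p).*2).-1.

Definition zigzag N (r : nat) : int * int :=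
  let w := fib_vec (zigzag_index N (r %% N)) in
  if odd (r %/ N) then - w else w.

Lemma zigzag_small N p : (p < N)%N -> zigzag N p = fib_vec (zigzag_index N p).
Proof. by move=> lt_pN; rewrite /zigzag divn_small // modn_small. Qed.

Lemma zigzag_period N r : (0 < N)%N -> zigzag N (r + N) = - zigzag N r.
Proof.
move=> N_gt0; rewrite /zigzag modnDr divnDr ?dvdnn // divnn N_gt0 addn1 /=.
by case: odd; rewrite /= ?opprK.
Qed.

(** When the smaller of the two positions is that of p it is even, and when it is
    that of q it is odd: either way this cancels the sign in d'Ocagne's
    identity. *)
Lemma det2_zigzag_small N p q : (p < q < N)%N ->
  let i := zigzag_index N p in let j := zigzag_index N q in
  det2 (zigzag N p) (zigzag N q) = (fib (maxn i j - minn i j))%:Z.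
Proof.
case/andP=> lt_pq lt_qN i j; rewrite !zigzag_small ?(ltn_trans lt_pq) // -/i -/j.
have [le_ij|lt_ji] := leqP i j.
  rewrite det2_fib_vec_even //.
  by move: le_ij; rewrite /i /j /zigzag_index; do 2![case: ifP => ?]; lia.
rewrite det2_fib_vec_odd //; last exact: ltnW.
by move: lt_ji; rewrite /i /j /zigzag_index; do 2![case: ifP => ?]; lia.
Qed.

(** Any chord is reduced to one between two of the first N vertices, taken in the
    opposite direction when it passes vertex N. *)
Lemma det2_zigzag N r k : (0 < k < N)%N ->
  exists p q, [/\ (p < q < N)%N,
    det2 (zigzag N r) (zigzag N (r + k)) = det2 (zigzag N p) (zigzag N q)
    & (q == p + k)%N || (q + k == p + N)%N].
Proof.
move=> k_in.
elim/ltn_ind: r => r IHr.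
have [lt_rN|le_Nr] := ltnP r N.
  have [lt_rk|le_rk] := ltnP (r + k) N.
    by exists r, (r + k)%N; split=> //; lia.
  exists (r + k - N)%N, r; split; [lia | | lia].
  rewrite -{1}(subnK le_rk) zigzag_period ?det2Nr -?det2C //; lia.
have [|p [q [lt_pq E pq]]] := IHr (r - N)%N; first lia.
exists p, q; split=> //; rewrite -E -{1 2}(subnK le_Nr) addnAC !zigzag_period; try lia.
by rewrite det2Nl det2Nr opprK.
Qed.

(** Neighbours on the polygon are at distance 1 or 2 along the zigzag, and
    F_1 = F_2 = 1. *)
Lemma zigzag_polygon N : (2 < N)%N -> polygon N (zigzag N).
Proof.
move=> N_gt2; split=> [r|r|r k k_in].
- by apply: zigzag_period; lia.
- have [|p [q [lt_pq E pq]]] := @det2_zigzag N r 1; first lia.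
  rewrite -addn1 E det2_zigzag_small //.
  set i := zigzag_index N p; set j := zigzag_index N q.
  have [->|->] // : (maxn i j - minn i j = 1)%N \/ (maxn i j - minn i j = 2)%N.
  by rewrite /i /j /zigzag_index; do 2![case: ifP => ?]; lia.
have [p [q [lt_pq -> _]]] := det2_zigzag r k_in.
rewrite det2_zigzag_small //.
set i := zigzag_index N p; set j := zigzag_index N q.
have : (0 < maxn i j - minn i j)%N by rewrite /i /j /zigzag_index; do 2![case: ifP => ?]; lia.
by case: (maxn i j - minn i j)%N => // d _; have := fib_gt0 d; lia.
Qed.

(** The chord from vertex 0, the start of the zigzag, to its end, at distance
    n + 2: the end is the vertex numbered half of n + 3, rounded down. *)
Lemma zigzag_table_max n : (0 < n)%N ->
  polygon_table n.+3 (zigzag n.+3) (uphalf n) 0 = (fib n.+2)%:Z.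
Proof.
move=> n_gt0; rewrite /polygon_table mod0z add0n det2_zigzag_small; last lia.
congr (fib _)%:Z; rewrite /zigzag_index uphalfE -[absz 0]/0%N double0 ltn0Sn.
by rewrite max0n min0n subn0; case: ifP => ?; lia.
Qed.

(** * The half turn and type C *)

(** By d'Ocagne's identity this linear map reverses the zigzag of length 2h, up to
    signs. *)
Definition half_turn h (x : int * int) : int * int :=
  (det2 x (fib_vec h.*2), det2 x (fib_vec h.*2.-1)).

Lemma half_turnN h x : half_turn h (- x) = - half_turn h x.
Proof. by rewrite /half_turn !det2Nl. Qed.

Lemma det2_half_turn h x y : (0 < h)%N ->
  det2 (half_turn h x) (half_turn h y) = det2 x y.
Proof.
move=> h_gt0; have E : det2 (fib_vec h.*2) (fib_vec h.*2.-1) = 1.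
  rewrite det2_fib_vec_odd ?leq_pred //; last lia.
  by rewrite (_ : h.*2 - h.*2.-1 = 1)%N //; lia.
by rewrite det2_coordinates E mul1r.
Qed.

Lemma half_turn_fib_vec h t : (t < h.*2)%N ->
  half_turn h (fib_vec t) =
  if odd t then - fib_vec (h.*2.-1 - t) else fib_vec (h.*2.-1 - t).
Proof.
move=> lt_t; rewrite /half_turn !det2_fib_vec; [|lia|lia].
rewrite -signr_odd (_ : h.*2 - t = (h.*2.-1 - t).+1)%N; last lia.
by case: odd; rewrite ?expr1 ?mulN1r ?expr0 ?mul1r.
Qed.

Lemma zigzag_half_turn h r : (0 < h)%N ->
  zigzag h.*2 (r + h) = half_turn h (zigzag h.*2 r).
Proof.
move=> h_gt0; have N_gt0 : (0 < h.*2)%N by rewrite double_gt0.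
elim/ltn_ind: r => r IHr.
have [lt_rN|le_Nr] := ltnP r h.*2; last first.
  rewrite -(subnK le_Nr) addnAC !zigzag_period // IHr ?half_turnN //; lia.
rewrite [zigzag _ r]zigzag_small // half_turn_fib_vec; last first.
  by rewrite /zigzag_index; case: ifP => ?; lia.
have [lt_rh|le_hr] := ltnP r h.
  rewrite zigzag_small; last lia.
  have -> : odd (zigzag_index h.*2 r) = false.
    by rewrite /zigzag_index; case: ifP => ?; lia.
  by congr fib_vec; rewrite /zigzag_index; do 2![case: ifP => ?]; lia.
rewrite (_ : r + h = r - h + h.*2)%N; last lia.
rewrite zigzag_period // zigzag_small; last lia.
have -> : odd (zigzag_index h.*2 r) = true.
  by rewrite /zigzag_index; case: ifP => ?; lia.
by congr (- fib_vec _); rewrite /zigzag_index; do 2![case: ifP => ?]; lia.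
Qed.

(** The half turn takes the chord from m to m + n + 2 to the one from m + n + 1 to
    m + 2n + 3, which is the chord from m + 1 to m + n + 1 with an end point
    opposed. *)
Lemma zigzag_table_symmetric n m : (0 < n)%N ->
  let g := polygon_table n.+1.*2 (zigzag n.+1.*2) in
  g n.+1 m = g n.-1 (m + 1).
Proof.
case: n => // n _ /=; have poly : polygon n.+2.*2 (zigzag n.+2.*2).
  by apply: zigzag_polygon.
rewrite polygon_tableS // /polygon_table; set r := `|_|%N.
rewrite -[LHS](@det2_half_turn n.+2) // -!zigzag_half_turn //.
rewrite (_ : r + n.+3 + n.+2 = r.+1 + n.+2.*2)%N; last lia.
by rewrite zigzag_period // det2Nr -det2C.
Qed.

(** * Largest values *)

Theorem theorem1 (n : nat) (hn : (0 < n)%N) (A : 'M[int]_n)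
    (hA : finite_type A) :
  (A = cartanA n -> is_max_frieze_value A (fib (n + 2))%:Z) /\
  (A = cartanC n -> is_max_frieze_value A (fib (2 * n + 1))%:Z).
Proof.
split=> {hA}->.
  rewrite addn2; split=> [|v [f [/(table_of_frieze (c := false)) tab [i [m ->]]]]].
    have tab := table_of_polygon (@zigzag_polygon n.+3 isT).
    have lt_i : ((uphalf n).-1 < n)%N by lia.
    exists (fun i : 'I_n => polygon_table n.+3 (zigzag n.+3) i.+1).
    split; first exact: (frieze_of_table tab).
    by exists (Ordinal lt_i), 0; rewrite /= prednK -?zigzag_table_max //; lia.
  by rewrite -(pad_rows_ord f); apply: (table_le_fib m tab); exact: ltnW (ltn_ord i).
have Nn : n.+1.*2 = n.*2.-1.+3 by lia.
have -> : (2 * n + 1 = n.*2.-1.+2)%N by lia.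
split=> [|v [f [/(table_of_frieze (c := true)) tab [i [m ->]]]]].
  have tab := table_of_polygon (@zigzag_polygon n.*2.-1.+3 isT).
  have sym m := @zigzag_table_symmetric n m hn; rewrite Nn in sym.
  have lt_n : (n.-1 < n)%N by rewrite prednK.
  eexists; split; first exact: (frieze_of_table (table_fold hn tab sym)).
  exists (Ordinal lt_n), 0; rewrite /= (prednK hn) ltn_eqF //.
  by rewrite -zigzag_table_max ?uphalfE; [congr polygon_table | ]; lia.
have := table_le_fib (i := i.+1) m (table_unfold hn tab).
by rewrite /unfold_table ltn_ord pad_rows_ord; apply; have := ltn_ord i; lia.
Qed.
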